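(* Let $\Gamma$ be a discrete group and $n\ge 1$. The map on cohomology $$H^n_{(1)}(\Gamma;\mathbf{R})\to H^{n-1}(\Gamma;\ell^\infty\Gamma/\mathbf{R})$$ induced by $\Lambda$ is an isomorphism. Its composition with the Bockstein (connecting) homomorphism $$H^{n-1}(\Gamma;\ell^\infty\Gamma/\mathbf{R})\to H^n(\Gamma;\mathbf{R})$$ corresponding to the short exact sequence of coefficients $0\to\mathbf{R}\to\ell^\infty\Gamma\to\ell^\infty\Gamma/\mathbf{R}\to 0$ is equal to the comparison map $H^n_{(1)}(\Gamma;\mathbf{R})\to H^n(\Gamma;\mathbf{R})$.
   Context: For a left $\Gamma$-module $V$, $C^n(\Gamma;V)$ is the space of all functions $\Gamma^n\to V$ (nonhomogeneous cochains), with $$\delta\alpha(g_1,\dots,g_{n+1})=g_1\alpha(g_2,\dots,g_{n+1})+\sum_{k=1}^{n}(-1)^k\alpha(g_1,\dots,g_kg_{k+1},\dots,g_{n+1})+(-1)^{n+1}\alpha(g_1,\dots,g_n),$$ and $H^*(\Gamma;V)$ is its cohomology. $\mathbf{R}$ is the trivial module. For $n\ge1$, a cochain $\omega\in C^n(\Gamma;\mathbf{R})$ is called 1-bounded if for all fixed $g_2,\dots,g_n\in\Gamma$ the function $g_1\mapsto\omega(g_1,g_2,\dots,g_n)$ is bounded; in degree $0$ all cochains are 1-bounded. The 1-bounded cochains form a subcomplex $C^*_{(1)}(\Gamma;\mathbf{R})$ of $C^*(\Gamma;\mathbf{R})$ with cohomology $H^*_{(1)}(\Gamma;\mathbf{R})$.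 The comparison map $H^n_{(1)}(\Gamma;\mathbf{R})\to H^n(\Gamma;\mathbf{R})$ is induced by the inclusion. $\ell^\infty\Gamma$ is the left $\Gamma$-module of bounded functions $F\colon\Gamma\to\mathbf{R}$ with action $(hF)(g)=F(gh)$, and $\mathbf{R}\subset\ell^\infty\Gamma$ is the submodule of constant functions. Define $\Lambda_0\colon C^n_{(1)}(\Gamma;\mathbf{R})\to C^{n-1}(\Gamma;\ell^\infty\Gamma)$ by $\Lambda_0\omega(g_1,\dots,g_{n-1})(h)=\omega(h,g_1,\dots,g_{n-1})$, and let $\Lambda\colon C^n_{(1)}(\Gamma;\mathbf{R})\to C^{n-1}(\Gamma;\ell^\infty\Gamma/\mathbf{R})$ be $\Lambda_0$ followed by the map induced by the quotient $\ell^\infty\Gamma\to\ell^\infty\Gamma/\mathbf{R}$. The map $\Lambda$ anticommutes with the codifferentials, hence induces a map on cohomology. *)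

(* Defs.v *)
From HB Require Import structures.
From mathcomp Require Import all_boot all_order all_algebra generic_quotient.
From mathcomp Require Import ring_quotient boolp classical_sets functions reals.
From mathcomp Require Import filter topology normedtype.

Set Implicit Arguments.
Unset Strict Implicit.
Unset Printing Implicit Defensive.

Import Order.TTheory GRing.Theory Num.Theory.
Import numFieldNormedType.Exports.
Import Quotient.

Local Open Scope ring_scope.
Local Open Scope quotient_scope.

Section Submodule.
Context {R : pzRingType} {V : lmodType R}.

Record submod (S : submodClosed V) :=
  Submod { submod_val :> V; submod_valP : submod_val \in S }.

Variable S : submodClosed V.

HB.instance Definition _ := [isSub of submod S for @submod_val S].
HB.instance Definition _ := [Choice of submod S by <:].
HB.instance Definition _ := [SubChoice_isSubLmodule of submod S by <:].

Lemma submod_val_is_linear : linear (@submod_val S).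
Proof. exact: (linearP (val : submod S -> V)). Qed.

HB.instance Definition _ :=
  GRing.isLinear.Build R (submod S) V _ (@submod_val S) submod_val_is_linear.

End Submodule.

Section SubmoduleLift.
Context {R : pzRingType} {U V : lmodType R}.
Variables (S : submodClosed V) (f : {linear U -> V}).
Hypothesis fS : forall u, f u \in S.

Definition submod_lift_fun u : submod S := Submod (fS u).

Lemma submod_lift_is_linear : linear submod_lift_fun.
Proof.
move=> a x y; apply: val_inj; rewrite (linearP (@submod_val _ _ S)).
by rewrite /= linearP.
Qed.

HB.instance Definition _ := GRing.isLinear.Build R U (submod S) _
  submod_lift_fun submod_lift_is_linear.

Definition submod_lift : {linear U -> submod S} := submod_lift_fun.

End SubmoduleLift.

Section LmodQuotient.
Context {R : pzRingType} {V : lmodType R}.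

(* [{quot _}] asks for a [zmodClosed] predicate, which [submodClosed] does not
   provide by inheritance. *)
Definition zpred (S : submodClosed V) : {pred V} := S.

Fact zpred_zmod_closed (S : submodClosed V) : zmod_closed (zpred S).
Proof.
split=> [|x y xS yS]; first exact: (rpred0 S).
by apply: (rpredD (S := S)) => //; rewrite -scaleN1r rpredZ.
Qed.

HB.instance Definition _ (S : submodClosed V) :=
  GRing.isZmodClosed.Build V (zpred S) (zpred_zmod_closed S).

Definition lquot (S : submodClosed V) := {quot zpred S}.

Variable S : submodClosed V.

HB.instance Definition _ := GRing.Zmodule.on (lquot S).

Definition lproj_fun (x : V) : lquot S := \pi_({quot zpred S}) x.
Definition lrepr (x : lquot S) : V := repr (x : {quot zpred S}).

Lemma lreprK x : lproj_fun (lrepr x) = x.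
Proof. exact: reprK. Qed.

Lemma lproj_eqP x y : (lproj_fun x = lproj_fun y) <-> (x - y \in S).
Proof.
rewrite (Quotient.idealrBE (zpred S)); split; first by move=> h; apply/eqP.
by move/eqP.
Qed.

Lemma lprojB : {morph lproj_fun : x y / x - y}.
Proof. exact: (raddfB (\pi_({quot zpred S}))). Qed.

Lemma lprojD : {morph lproj_fun : x y / x + y}.
Proof. exact: (raddfD (\pi_({quot zpred S}))). Qed.

Definition lscale (a : R) (x : lquot S) : lquot S := lproj_fun (a *: lrepr x).

Lemma lscaleE a x : lscale a (lproj_fun x) = lproj_fun (a *: x).
Proof.
by apply/lproj_eqP; rewrite -scalerBr rpredZ//; apply/lproj_eqP/lreprK.
Qed.

Fact lscaleA a b x : lscale a (lscale b x) = lscale (a * b) x.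
Proof. by rewrite -[x]lreprK !lscaleE scalerA. Qed.
Fact lscale1 : left_id 1 lscale.
Proof. by move=> x; rewrite -[x]lreprK lscaleE scale1r. Qed.
Fact lscaleDr : right_distributive lscale +%R.
Proof.
move=> a x y; rewrite -[x]lreprK -[y]lreprK -lprojD !lscaleE -lprojD.
by rewrite scalerDr.
Qed.
Fact lscaleDl x : {morph lscale^~ x : a b / a + b}.
Proof. by move=> a b; rewrite -[x]lreprK !lscaleE -lprojD scalerDl. Qed.

HB.instance Definition _ := GRing.Zmodule_isLmodule.Build R (lquot S)
  lscaleA lscale1 lscaleDr lscaleDl.

Lemma lproj_is_linear : linear lproj_fun.
Proof. by move=> a x y; rewrite lprojD -lscaleE. Qed.

HB.instance Definition _ :=
  GRing.isLinear.Build R V (lquot S) _ lproj_fun lproj_is_linear.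

Definition lproj : {linear V -> lquot S} := lproj_fun.

Lemma lproj_surj (x : lquot S) : exists v, lproj v = x.
Proof. by exists (lrepr x); exact: lreprK. Qed.

Lemma lproj_eq0 v : lproj v = 0 <-> v \in S.
Proof. by rewrite -{2}[v]subr0 -lproj_eqP -/(lproj 0) linear0. Qed.

Section Factor.
Variables (W : lmodType R) (f : {linear V -> W}).
Hypothesis fS : forall v, v \in S -> f v = 0.

Definition lfactor_fun (x : lquot S) : W := f (lrepr x).

Lemma lfactorE v : lfactor_fun (lproj v) = f v.
Proof.
apply/eqP; rewrite -subr_eq0 -linearB; apply/eqP/fS/lproj_eqP; exact: lreprK.
Qed.

Lemma lfactor_is_linear : linear lfactor_fun.
Proof.
move=> a x y; case: (lproj_surj x) (lproj_surj y) => u <- [v <-].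
by rewrite -linearP !lfactorE linearP.
Qed.

HB.instance Definition _ := GRing.isLinear.Build R (lquot S) W _
  lfactor_fun lfactor_is_linear.

Definition lfactor : {linear lquot S -> W} := lfactor_fun.

End Factor.
End LmodQuotient.

Section Complexes.
Variable R : pzRingType.

Record cochain_complex := CochainComplex {
  cochain :> nat -> lmodType R;
  codiff : forall n, {linear cochain n -> cochain n.+1};
  codiffK : forall n (a : cochain n), codiff n.+1 (codiff n a) = 0
}.

Arguments codiff {_ n}.

Definition cocycle (C : cochain_complex) n : {pred C n} :=
  [pred a | codiff a == 0].

(* The complex is extended by 0 in negative degrees. *)
Definition is_coboundary (C : cochain_complex) n : C n -> Prop :=
  match n return C n -> Prop with
  | 0 => fun a => a = 0
  | m.+1 => fun a => exists b : C m, codiff b = a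
  end.

Section Cohomology.
Variables (C : cochain_complex) (n : nat).

Lemma cocycle_submod_closed : subsemimod_closed (@cocycle C n).
Proof.
split=> [|a x]; last by rewrite !inE => /eqP xZ; rewrite linearZ/= xZ scaler0.
split=> [|x y]; first by rewrite inE linear0.
by rewrite !inE => /eqP xZ /eqP yZ; rewrite linearD/= xZ yZ addr0.
Qed.

HB.instance Definition _ :=
  GRing.isSubmodClosed.Build R (C n) (@cocycle C n) cocycle_submod_closed.

Definition cocycles := submod (@cocycle C n).

HB.instance Definition _ := GRing.Lmodule.on cocycles.

Definition coboundary : {pred cocycles} :=
  [pred z : cocycles | `[< is_coboundary (submod_val z) >]].

Lemma is_coboundary0 : is_coboundary (0 : C n).
Proof. by case: n => //= m; exists 0; rewrite linear0. Qed.

Lemma is_coboundaryP a (x y : C n) :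
  is_coboundary x -> is_coboundary y -> is_coboundary (a *: x + y).
Proof.
case: n x y => /= [x y -> ->|m x y [b <-] [c <-]].
  by rewrite scaler0 addr0.
by exists (a *: b + c); rewrite linearP.
Qed.

Lemma coboundaryP (z : cocycles) :
  z \in coboundary <-> is_coboundary (submod_val z).
Proof. by rewrite inE. Qed.

Lemma coboundary_submod_closed : subsemimod_closed coboundary.
Proof.
split=> [|a x /coboundaryP xB]; last first.
  apply/coboundaryP; rewrite linearZ/= -[_ *: _]addr0.
  by apply: is_coboundaryP => //; exact: is_coboundary0.
split=> [|x y /coboundaryP xB /coboundaryP yB]; apply/coboundaryP.
  by rewrite linear0; exact: is_coboundary0.
by rewrite linearD/= -[submod_val x]scale1r; exact: is_coboundaryP.
Qed.

HB.instance Definition _ :=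
  GRing.isSubmodClosed.Build R cocycles coboundary coboundary_submod_closed.

Definition cohomology : lmodType R := lquot coboundary.

Definition cohomology_class : {linear cocycles -> cohomology} :=
  lproj coboundary.

Lemma cohomology_class_surj (x : cohomology) :
  exists z, cohomology_class z = x.
Proof. exact: lproj_surj. Qed.

Lemma cohomology_class_eq0 z :
  cohomology_class z = 0 <-> is_coboundary (submod_val z).
Proof. by rewrite lproj_eq0 coboundaryP. Qed.

Lemma cocycleP (z : cocycles) : codiff (submod_val z) = 0.
Proof. by apply/eqP; have := submod_valP z; rewrite inE. Qed.

Lemma cocycleI (a : C n) : codiff a = 0 -> a \in @cocycle C n.
Proof. by move=> aZ; rewrite inE aZ. Qed.

End Cohomology.

Section InducedMap.
Variables (C D : cochain_complex) (m n : nat) (f : {linear C m -> D n}).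
Hypothesis f_cocycle : forall a, codiff a = 0 -> codiff (f a) = 0.
Hypothesis f_coboundary : forall a, is_coboundary a -> is_coboundary (f a).

Let fval : {linear cocycles C m -> D n} := f \o @submod_val _ _ _.

Fact induced_cocycle (z : cocycles C m) : fval z \in @cocycle D n.
Proof. exact/cocycleI/f_cocycle/cocycleP. Qed.

Definition cocycle_map : {linear cocycles C m -> cocycles D n} :=
  submod_lift induced_cocycle.

Let class_map : {linear cocycles C m -> cohomology D n} :=
  @cohomology_class D n \o cocycle_map.

Fact induced_coboundary z : z \in @coboundary C m -> class_map z = 0.
Proof. by move=> /coboundaryP zB; apply/cohomology_class_eq0/f_coboundary. Qed.

Definition induced : {linear cohomology C m -> cohomology D n} :=
  lfactor induced_coboundary.

Lemma inducedE z :
  induced (cohomology_class C m z) = cohomology_class D n (cocycle_map z).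
Proof. exact: (lfactorE induced_coboundary z). Qed.

End InducedMap.

Record cochain_map (C D : cochain_complex) := CochainMap {
  cmap :> forall n, {linear C n -> D n};
  cmap_codiff : forall n (a : C n), codiff (cmap n a) = cmap n.+1 (codiff a)
}.

Section CochainMapCohomology.
Variables (C D : cochain_complex) (f : cochain_map C D) (n : nat).

Fact cmap_cocycle (a : C n) : codiff a = 0 -> codiff (f n a) = 0.
Proof. by move=> aZ; rewrite cmap_codiff aZ linear0. Qed.

Fact cmap_coboundary (a : C n) : is_coboundary a -> is_coboundary (f n a).
Proof.
case: n a => [a ->|m a [b <-]] /=; first exact: linear0.
by exists (f m b); rewrite cmap_codiff.
Qed.

Definition cohomology_map : {linear cohomology C n -> cohomology D n} :=
  induced cmap_cocycle cmap_coboundary.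

End CochainMapCohomology.

Section Subcomplex.
Variables (C : cochain_complex) (S : forall n, submodClosed (C n)).
Hypothesis S_codiff : forall n a, a \in S n -> codiff a \in S n.+1.

Let codiff_val n : {linear submod (S n) -> C n.+1} :=
  codiff \o @submod_val _ _ (S n).

Fact subcodiff_subproof n (a : submod (S n)) : codiff_val n a \in S n.+1.
Proof. exact/S_codiff/submod_valP. Qed.

Definition subcodiff n : {linear submod (S n) -> submod (S n.+1)} :=
  submod_lift (@subcodiff_subproof n).

Fact subcodiffK n (a : submod (S n)) : subcodiff n.+1 (subcodiff n a) = 0.
Proof. by apply: val_inj; rewrite /= codiffK. Qed.

Definition subcomplex : cochain_complex :=
  @CochainComplex (fun n => submod (S n)) subcodiff subcodiffK.

Definition subcomplex_incl : cochain_map subcomplex C :=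
  @CochainMap subcomplex C (fun n => @submod_val _ _ (S n)) (fun n a => erefl).

End Subcomplex.

Record short_exact_complexes (A B C : cochain_complex) := ShortExactComplexes {
  ses_inj : cochain_map A B;
  ses_proj : cochain_map B C;
  ses_injective : forall n, injective (ses_inj n);
  ses_surjective : forall n (c : C n), exists b, ses_proj n b = c;
  ses_exact : forall n (b : B n),
    ses_proj n b = 0 <-> exists a, ses_inj n a = b
}.

Section Connecting.
Variables (A B C : cochain_complex) (E : short_exact_complexes A B C) (n : nat).

Local Notation i := (ses_inj E).
Local Notation p := (ses_proj E).

(* [zigzag c a]: the cochain [a] is obtained from [c] by lifting it to the
   middle complex, applying the codifferential, and pulling back to the left
   complex. *)
Definition zigzag (c : C n) (a : A n.+1) : Prop :=
  exists2 b : B n, p n b = c & i n.+1 a = codiff b.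

Lemma zigzag_exists (c : cocycles C n) :
  exists a : cocycles A n.+1, zigzag (submod_val c) (submod_val a).
Proof.
have [b pb] := ses_surjective E (submod_val c).
have [a ia] : exists a, i n.+1 a = codiff b.
  by apply/ses_exact; rewrite -cmap_codiff pb cocycleP.
have aZ : codiff a = 0.
  apply: (@ses_injective _ _ _ E); rewrite -cmap_codiff ia codiffK.
  by rewrite linear0.
by exists (Submod (cocycleI aZ)); exists b.
Qed.

Lemma zigzag_linear k c1 a1 c2 a2 : zigzag c1 a1 -> zigzag c2 a2 ->
  zigzag (k *: c1 + c2) (k *: a1 + a2).
Proof.
move=> [b1 <- ia1] [b2 <- ia2]; exists (k *: b1 + b2); first by rewrite linearP.
by rewrite !linearP ia1 ia2.
Qed.

Lemma zigzag_coboundary c a : is_coboundary c -> zigzag c a -> is_coboundary a.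
Proof.
move=> cB [b pb ia].
suff [b' pb' db'] : exists2 b' : B n, p n b' = c & codiff b' = 0.
  have [a' ia'] : exists a', i n a' = b - b'.
    by apply/ses_exact; rewrite linearB/= pb pb' subrr.
  exists a'; apply: (@ses_injective _ _ _ E).
  by rewrite -cmap_codiff ia' linearB/= db' subr0.
case: n c cB {a b pb ia} => /= [_ ->|m _ [c <-]].
  by exists 0; rewrite linear0.
have [b pb] := ses_surjective E c.
by exists (codiff b); rewrite ?codiffK// -cmap_codiff pb.
Qed.

Definition zigzag_cocycle (c : cocycles C n) : cocycles A n.+1 :=
  sval (cid (zigzag_exists c)).

Lemma zigzag_cocycleP c :
  zigzag (submod_val c) (submod_val (zigzag_cocycle c)).
Proof. exact: svalP (cid (zigzag_exists c)). Qed.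

Definition connecting_fun (x : cohomology C n) : cohomology A n.+1 :=
  cohomology_class A n.+1 (zigzag_cocycle (lrepr x)).

Lemma connecting_funE (c : cocycles C n) (a : cocycles A n.+1) :
  zigzag (submod_val c) (submod_val a) ->
  connecting_fun (cohomology_class C n c) = cohomology_class A n.+1 a.
Proof.
move=> ca; set c' := lrepr (cohomology_class C n c).
have c'E : cohomology_class C n c' = cohomology_class C n c by exact: lreprK.
apply/eqP; rewrite -subr_eq0 -linearB; apply/eqP/cohomology_class_eq0.
apply: (@zigzag_coboundary (submod_val (c' - c))).
  by apply/cohomology_class_eq0; rewrite linearB/= c'E subrr.
rewrite !linearB/= [X in zigzag X _]addrC [X in zigzag _ X]addrC.
by rewrite -!scaleN1r; apply: zigzag_linear => //; exact: zigzag_cocycleP.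
Qed.

Lemma connecting_is_linear : linear connecting_fun.
Proof.
move=> k x y; have [c <-] := cohomology_class_surj x.
have [d <-] := cohomology_class_surj y.
rewrite (connecting_funE (zigzag_cocycleP c)).
rewrite (connecting_funE (zigzag_cocycleP d)).
rewrite -!(linearP (cohomology_class _ _)); apply: connecting_funE.
by rewrite !linearP; apply: zigzag_linear; exact: zigzag_cocycleP.
Qed.

HB.instance Definition _ :=
  GRing.isLinear.Build R (cohomology C n) (cohomology A n.+1) _
    connecting_fun connecting_is_linear.

Definition connecting : {linear cohomology C n -> cohomology A n.+1} :=
  connecting_fun.

(* Independence of the choices made in [zigzag_cocycle]. *)
Lemma connectingE (c : cocycles C n) (a : cocycles A n.+1) (b : B n) :
  p n b = submod_val c -> i n.+1 (submod_val a) = codiff b ->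
  connecting (cohomology_class C n c) = cohomology_class A n.+1 a.
Proof. by move=> pb ia; apply: connecting_funE; exists b. Qed.

End Connecting.
End Complexes.

Arguments codiff {R _ n}.

Section GroupModules.
Variables (G : groupType) (R : pzRingType).

Record gmodule := GModule {
  gmod_sort :> lmodType R;
  gact : G -> {linear gmod_sort -> gmod_sort};
  gact1 : forall v, gact 1%g v = v;
  gactM : forall g h v, gact (g * h)%g v = gact g (gact h v)
}.

Arguments gact {_}.

(* [R^o] is the ring R seen as a module over itself. *)
Definition gtrivial : gmodule :=
  @GModule R^o (fun _ => idfun) (fun _ => erefl) (fun _ _ _ => erefl).

Section Coinduced.
Variable V : lmodType R.

Definition rtransl_fun (h : G) (F : G -> V) : G -> V := fun g => F (g * h)%g.

Lemma rtransl_is_linear h : linear (rtransl_fun h).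
Proof. by []. Qed.

HB.instance Definition _ h := GRing.isLinear.Build R (G -> V) (G -> V) _
  (rtransl_fun h) (rtransl_is_linear h).

Fact rtransl1 F : rtransl_fun 1%g F = F.
Proof. by apply/funext => g; rewrite /rtransl_fun mulg1. Qed.

Fact rtranslM h k F :
  rtransl_fun (h * k)%g F = rtransl_fun h (rtransl_fun k F).
Proof. by apply/funext => g; rewrite /rtransl_fun mulgA. Qed.

(* [G] acts by (h F)(g) = F (g h); the action on [V], if any, is not used. *)
Definition gcoind : gmodule :=
  @GModule (G -> V) (fun h => rtransl_fun h) rtransl1 rtranslM.

End Coinduced.

Section SubQuotient.
Variables (V : gmodule) (S : submodClosed V).
Hypothesis S_stable : forall g v, v \in S -> gact g v \in S.

Let act_val g : {linear submod S -> V} := gact g \o @submod_val _ _ S.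
Let act_proj g : {linear V -> lquot S} := lproj S \o gact g.

Fact gsub_act_subproof g v : act_val g v \in S.
Proof. exact/S_stable/submod_valP. Qed.

Definition gsub_act g : {linear submod S -> submod S} :=
  submod_lift (gsub_act_subproof g).

Fact gsub_act1 v : gsub_act 1%g v = v.
Proof. by apply: val_inj; rewrite /= gact1. Qed.

Fact gsub_actM g h v : gsub_act (g * h)%g v = gsub_act g (gsub_act h v).
Proof. by apply: val_inj; rewrite /= gactM. Qed.

Definition gsub : gmodule := @GModule (submod S) gsub_act gsub_act1 gsub_actM.

Fact gquot_act_subproof g v : v \in S -> act_proj g v = 0.
Proof. by move=> vS; apply/lproj_eq0/S_stable. Qed.

Definition gquot_act g : {linear lquot S -> lquot S} :=
  lfactor (gquot_act_subproof g).

Lemma gquot_actE g v : gquot_act g (lproj S v) = lproj S (gact g v).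
Proof. exact: (lfactorE (gquot_act_subproof g)). Qed.

Fact gquot_act1 v : gquot_act 1%g v = v.
Proof. by have [u <-] := lproj_surj v; rewrite gquot_actE gact1. Qed.

Fact gquot_actM g h v : gquot_act (g * h)%g v = gquot_act g (gquot_act h v).
Proof. by have [u <-] := lproj_surj v; rewrite !gquot_actE gactM. Qed.

Definition gquot : gmodule :=
  @GModule (lquot S) gquot_act gquot_act1 gquot_actM.

End SubQuotient.

Section Cochains.

(* The tuple (h, g_1, ..., g_n). *)
Definition gcons n (h : G) (g : 'I_n -> G) : 'I_n.+1 -> G :=
  fun i => if unlift ord0 i is Some j then g j else h.

(* For 0-based k, the tuple (g_0, ..., g_k g_(k+1), ..., g_n). *)
Definition gmerge n (k : 'I_n) (g : 'I_n.+1 -> G) : 'I_n -> G :=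
  fun i => if (i < k)%N then g (widen_ord (leqnSn n) i)
           else if i == k then (g (widen_ord (leqnSn n) i) * g (lift ord0 i))%g
           else g (lift ord0 i).

Variable V : gmodule.

(* The argument (g_1, ..., g_(n+1)) is indexed from 0 in [g : 'I_n.+1 -> G], so
   that the usual summand of index k in 1..n is the one of index k - 1 here. *)
Definition gcodiff_fun n (a : ('I_n -> G) -> V) : ('I_n.+1 -> G) -> V :=
  fun g => gact (g ord0) (a (fun i => g (lift ord0 i)))
    + \sum_(k < n) (-1) ^+ k.+1 *: a (gmerge k g)
    + (-1) ^+ n.+1 *: a (fun i => g (widen_ord (leqnSn n) i)).

Lemma scaler_signP n c (x y : V) :
  (-1) ^+ n *: (c *: x + y) = c *: ((-1) ^+ n *: x) + (-1) ^+ n *: y.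
Proof. by rewrite scalerDr !scalerA -(commr_sign c n). Qed.

Lemma gcodiff_is_linear n : linear (@gcodiff_fun n).
Proof.
move=> c a b; apply/funext => g; rewrite /gcodiff_fun.
under eq_bigr => k _ do rewrite scaler_signP.
rewrite big_split -scaler_sumr scaler_signP linearP /=.
by rewrite [X in X + _ = _]addrACA [LHS]addrACA -!scalerDr.
Qed.

HB.instance Definition _ n := GRing.isLinear.Build R
  (('I_n -> G) -> V) (('I_n.+1 -> G) -> V) _ (@gcodiff_fun n)
  (@gcodiff_is_linear n).

Definition gcodiff n :
  {linear (('I_n -> G) -> V) -> (('I_n.+1 -> G) -> V)} := @gcodiff_fun n.

Definition curry_cochain n (a : ('I_n.+1 -> G) -> V) :
    ('I_n -> G) -> gcoind V :=
  fun g h => a (gcons h g).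

Lemma gcons0 n h (g : 'I_n -> G) : gcons h g ord0 = h.
Proof. by rewrite /gcons unlift_none. Qed.

Lemma gconsS n h (g : 'I_n -> G) i : gcons h g (lift ord0 i) = g i.
Proof. by rewrite /gcons liftK. Qed.

Lemma gcons_eta n (g : 'I_n.+1 -> G) :
  gcons (g ord0) (fun i => g (lift ord0 i)) = g.
Proof.
apply/funext => i; rewrite /gcons; case: unliftP => [j|] -> //.
Qed.

Lemma gmerge0_gcons n h (g : 'I_n.+1 -> G) :
  gmerge ord0 (gcons h g) = gcons (h * g ord0)%g (fun i => g (lift ord0 i)).
Proof.
apply/funext => i; rewrite /gmerge ltn0 [RHS]/gcons.
case: unliftP => [j ->|->]; first by rewrite gconsS.
rewrite eqxx gconsS; congr (_ * _)%g.
by rewrite -[RHS](gcons0 h g); congr gcons; apply: val_inj.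
Qed.

Lemma gmergeS_gcons n h (g : 'I_n.+1 -> G) (k : 'I_n) :
  gmerge (lift ord0 k) (gcons h g) = gcons h (gmerge k g).
Proof.
apply/funext => i; case: (unliftP ord0 i) => [j ->|->].
  rewrite gconsS /gmerge !lift0 ltnS (inj_eq lift_inj) !gconsS.
  suff -> : widen_ord (leqnSn n.+1) (lift ord0 j)
            = lift ord0 (widen_ord (leqnSn n) j) by rewrite gconsS.
  exact: val_inj.
rewrite gcons0 /gmerge lift0 /= -[RHS](gcons0 h g); congr gcons.
exact: val_inj.
Qed.

Lemma gcons_widen n h (g : 'I_n.+1 -> G) :
  (fun i => gcons h g (widen_ord (leqnSn n.+1) i))
  = gcons h (fun i => g (widen_ord (leqnSn n) i)).
Proof.
apply/funext => i; case: (unliftP ord0 i) => [j ->|->].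
  suff -> : widen_ord (leqnSn n.+1) (lift ord0 j)
            = lift ord0 (widen_ord (leqnSn n) j) by rewrite !gconsS.
  exact: val_inj.
rewrite gcons0 -[RHS](gcons0 h g); congr gcons.
exact: val_inj.
Qed.

End Cochains.

Arguments gcodiff V {n}.

Lemma curry_gcodiff (V : gmodule) n (a : ('I_n.+1 -> G) -> V) g h :
  gcodiff V a (gcons h g)
  = gact h (a g) - gcodiff (gcoind V) (curry_cochain a) g h.
Proof.
rewrite /gcodiff /= /gcodiff_fun gcons0; under eq_fun do rewrite gconsS.
rewrite big_ord_recl gmerge0_gcons gcons_widen expr1 scaleN1r.
under eq_bigr => k _ do rewrite gmergeS_gcons lift0 exprS mulN1r scaleNr.
rewrite sumrN exprS mulN1r scaleNr -!addrA; congr (_ + _).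
rewrite -!opprD !addrA; congr (- _).
by rewrite !fctE; do 2 congr (_ + _); rewrite fct_sumE.
Qed.

Record gmod_hom (U V : gmodule) := GmodHom {
  ghom :> {linear U -> V};
  ghom_act : forall g u, ghom (gact g u) = gact g (ghom u)
}.

Lemma gcodiff_ghom (U V : gmodule) (f : gmod_hom U V) n
    (a : ('I_n -> G) -> U) : gcodiff V (f \o a) = f \o gcodiff U a.
Proof.
apply/funext => g; rewrite /= /gcodiff_fun.
rewrite !linearD linear_sum -ghom_act linearZ.
by congr (_ + _ + _); apply: eq_bigr => k _; rewrite linearZ.
Qed.

Section OrbitMap.
Variable V : gmodule.

Definition gorbit_fun (v : V) : gcoind V := fun h => gact h v.

Lemma gorbit_is_linear : linear gorbit_fun.
Proof. by move=> c u v; apply/funext => h; rewrite /gorbit_fun linearP. Qed.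

HB.instance Definition _ :=
  GRing.isLinear.Build R V (gcoind V) _ gorbit_fun gorbit_is_linear.

Fact gorbit_act g v : gorbit_fun (gact g v) = gact g (gorbit_fun v).
Proof.
by apply/funext => h; rewrite /gorbit_fun /= /rtransl_fun gactM.
Qed.

Definition gorbit : gmod_hom V (gcoind V) :=
  @GmodHom V (gcoind V) gorbit_fun gorbit_act.

End OrbitMap.

Lemma curry_gcodiffE (V : gmodule) n (a : ('I_n.+1 -> G) -> V) :
  curry_cochain (gcodiff V a)
  = gorbit V \o a - gcodiff (gcoind V) (curry_cochain a).
Proof. by apply/funext => g; apply/funext => h; exact: curry_gcodiff. Qed.

Lemma gcodiff0E (V : gmodule) (a : ('I_0 -> G) -> V) g e :
  gcodiff V a g = gact (g ord0) (a e) - a e.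
Proof.
rewrite /= /gcodiff_fun big_ord0 addr0 expr1 scaleN1r.
by congr (gact _ (a _) - a _); apply/funext => -[].
Qed.

Arguments gcodiff0E {V a} g e.

Lemma gcodiffK (V : gmodule) n (a : ('I_n -> G) -> V) :
  gcodiff V (gcodiff V a) = 0.
Proof.
elim: n V a => [|n IHn] V a; apply/funext => g;
  rewrite -(gcons_eta g) curry_gcodiff.
  pose u : 'I_0 -> G := fun i => g (lift ord0 (lift ord0 i)).
  rewrite (gcodiff0E (a := a) _ u) (gcodiff0E _ u) !fctE.
  rewrite [gact _ (curry_cochain _ _)]/(rtransl_fun _ _) /rtransl_fun.
  rewrite /curry_cochain !(gcodiff0E _ u) !gcons0 gactM linearB /=.
  have E (x y z : V) : x - y - (x - z - (y - z)) = 0.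
    by rewrite (opprB y) addrA subrK subrr.
  exact: E.
rewrite curry_gcodiffE linearB IHn subr0 gcodiff_ghom.
by rewrite subrr.
Qed.

Definition gcomplex (V : gmodule) : cochain_complex R :=
  @CochainComplex R (fun n => ('I_n -> G) -> V) (fun n => gcodiff V)
    (@gcodiffK V).

Section CoefficientMap.
Variables (U V : gmodule) (f : gmod_hom U V).

Definition coef_map_fun n (a : gcomplex U n) : gcomplex V n := f \o a.

Lemma coef_map_is_linear n : linear (@coef_map_fun n).
Proof.
by move=> c a b; apply/funext => g; rewrite /coef_map_fun /= linearP.
Qed.

HB.instance Definition _ n := GRing.isLinear.Build R (gcomplex U n)
  (gcomplex V n) _ (@coef_map_fun n) (@coef_map_is_linear n).

Definition coef_map : cochain_map (gcomplex U) (gcomplex V) :=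
  @CochainMap R (gcomplex U) (gcomplex V) (fun n => @coef_map_fun n)
    (fun n a => gcodiff_ghom f a).

End CoefficientMap.

Record short_exact_gmodules (U V W : gmodule) := ShortExactGmodules {
  gses_inj : gmod_hom U V;
  gses_proj : gmod_hom V W;
  gses_injective : injective gses_inj;
  gses_surjective : forall w, exists v, gses_proj v = w;
  gses_exact : forall v, gses_proj v = 0 <-> exists u, gses_inj u = v
}.

Section Bockstein.
Variables (U V W : gmodule) (E : short_exact_gmodules U V W).

Fact coef_injective n : injective (coef_map (gses_inj E) n).
Proof.
move=> a b ab; apply/funext => g; apply: (gses_injective (s := E)).
by have := congr1 (@^~ g) ab.
Qed.

Fact coef_surjective n (c : gcomplex W n) :
  exists b, coef_map (gses_proj E) n b = c.
Proof.
exists (fun g => sval (cid (gses_surjective E (c g)))).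
by apply/funext => g; exact: svalP (cid (gses_surjective E (c g))).
Qed.

Fact coef_exact n (b : gcomplex V n) :
  coef_map (gses_proj E) n b = 0 <-> exists a, coef_map (gses_inj E) n a = b.
Proof.
split=> [pb|[a <-]]; last first.
  by apply/funext => g; apply/(gses_exact E); exists (a g).
have pbg g : exists u, gses_inj E u = b g.
  by apply/gses_exact; exact: (congr1 (@^~ g) pb).
exists (fun g => sval (cid (pbg g))).
by apply/funext => g; exact: svalP (cid (pbg g)).
Qed.

Definition short_exact_coef :
    short_exact_complexes (gcomplex U) (gcomplex V) (gcomplex W) :=
  ShortExactComplexes coef_injective coef_surjective coef_exact.

Definition bockstein n :
  {linear cohomology (gcomplex W) n -> cohomology (gcomplex U) n.+1} :=
  connecting short_exact_coef n.

End Bockstein.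

End GroupModules.

Arguments gact {G R _}.
Arguments gcodiff {G R} V {n}.
Arguments gcodiff0E {G R V a} g e.

Section OneBounded.
Variables (G : groupType) (R : realType).

Local Notation Rtriv := (gtrivial G R).
Local Notation CR := (gcomplex Rtriv).

Definition bounded_pred : {pred gcoind G R^o} :=
  [pred F : G -> R^o | `[< bounded_fun F >]].

Lemma bounded_predP (F : G -> R^o) : F \in bounded_pred <-> bounded_fun F.
Proof. by rewrite inE. Qed.

Lemma bounded_fun_exP (F : G -> R^o) :
  bounded_fun F <-> exists M : R, forall g, `|F g| <= M.
Proof.
have PF : ProperFilter (globally [set: G]).
  exact: (@globally_properfilter _ _ (1%g : G)).
rewrite /= ex_bound; split=> -[M FM]; exists M => g; first exact: FM.
by move=> _; exact: FM.
Qed.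

Lemma bounded_predE (F : G -> R^o) :
  F \in bounded_pred <-> exists M : R, forall g, `|F g| <= M.
Proof. by rewrite bounded_predP bounded_fun_exP. Qed.

Lemma bounded_submod_closed : subsemimod_closed bounded_pred.
Proof.
split=> [|a F]; last first.
  move=> /bounded_predE[M FM]; apply/bounded_predE.
  by exists (`|a| * M) => g; rewrite normrM ler_wpM2l.
split=> [|E F].
  by apply/bounded_predE; exists 0 => g; rewrite normr0.
move=> /bounded_predE[M EM] /bounded_predE[N FN].
apply/bounded_predE; exists (M + N) => g.
by rewrite (le_trans (ler_normD _ _))// lerD.
Qed.

HB.instance Definition _ := GRing.isSubmodClosed.Build R (gcoind G R^o)
  bounded_pred bounded_submod_closed.

Fact bounded_act g F : F \in bounded_pred -> gact g F \in bounded_pred.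
Proof.
move=> /bounded_predE[M FM]; apply/bounded_predE.
by exists M => h; exact: FM.
Qed.

Definition linfty : gmodule G R := gsub bounded_act.

Definition constant_pred : {pred linfty} :=
  [pred F : linfty | `[< exists c : R, submod_val F = cst c >]].

Lemma constant_predP (F : linfty) :
  F \in constant_pred <-> exists c : R, submod_val F = cst c.
Proof. by rewrite inE. Qed.

Lemma constant_submod_closed : subsemimod_closed constant_pred.
Proof.
split=> [|a F /constant_predP[c Fc]]; last first.
  by apply/constant_predP; exists (a * c); rewrite linearZ /= Fc.
split=> [|E F /constant_predP[c Ec] /constant_predP[d Fd]].
  by apply/constant_predP; exists 0; rewrite linear0.
by apply/constant_predP; exists (c + d); rewrite linearD /= Ec Fd.
Qed.

HB.instance Definition _ := GRing.isSubmodClosed.Build R linfty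
  constant_pred constant_submod_closed.

Fact constant_act g F : F \in constant_pred -> gact g F \in constant_pred.
Proof.
move=> /constant_predP[c Fc]; apply/constant_predP; exists c.
by rewrite /= Fc.
Qed.

Definition linfty_mod_const : gmodule G R := gquot constant_act.

Fact const_bounded (c : R^o) : cst c \in bounded_pred.
Proof. by apply/bounded_predE; exists `|c|. Qed.

Definition const_linfty_fun (c : Rtriv) : linfty := Submod (const_bounded c).

Lemma const_linfty_is_linear : linear const_linfty_fun.
Proof. by move=> a c d; apply: val_inj. Qed.

HB.instance Definition _ := GRing.isLinear.Build R Rtriv linfty _
  const_linfty_fun const_linfty_is_linear.

Fact const_linfty_act g c :
  const_linfty_fun (gact g c) = gact g (const_linfty_fun c).
Proof. exact: val_inj. Qed.

Definition const_linfty : gmod_hom Rtriv linfty :=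
  @GmodHom _ _ Rtriv linfty const_linfty_fun const_linfty_act.

Fact linfty_proj_act g F :
  lproj constant_pred (gact g F)
  = gact g (lproj constant_pred F : linfty_mod_const).
Proof. by rewrite -(gquot_actE constant_act). Qed.

Definition linfty_proj : gmod_hom linfty linfty_mod_const :=
  @GmodHom _ _ linfty linfty_mod_const (lproj constant_pred) linfty_proj_act.

Fact const_linfty_injective : injective const_linfty.
Proof.
by move=> c d /(congr1 (fun F : linfty => submod_val F 1%g)).
Qed.

Fact linfty_surjective (F : linfty_mod_const) : exists E, linfty_proj E = F.
Proof. exact: lproj_surj. Qed.

Fact linfty_exact (F : linfty) :
  linfty_proj F = 0 <-> exists c, const_linfty c = F.
Proof.
split=> [/lproj_eq0/constant_predP[c Fc]|[c <-]].
  by exists c; apply: val_inj; rewrite /= Fc.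
by apply/lproj_eq0/constant_predP; exists c.
Qed.

Definition linfty_ses : short_exact_gmodules Rtriv linfty linfty_mod_const :=
  ShortExactGmodules const_linfty_injective linfty_surjective
    linfty_exact.

Definition one_bounded n : CR n -> Prop :=
  match n return CR n -> Prop with
  | 0 => fun=> True
  | m.+1 => fun w => forall g : 'I_m -> G,
      bounded_fun (fun h => w (gcons h g) : R^o)
  end.

Definition one_bounded_pred n : {pred CR n} :=
  [pred w : CR n | `[< one_bounded w >]].

Lemma one_bounded_predP n (w : CR n) :
  w \in @one_bounded_pred n <-> one_bounded w.
Proof. by rewrite inE. Qed.

Lemma one_bounded_predS n (w : CR n.+1) :
  w \in @one_bounded_pred n.+1 <->
  forall g, curry_cochain w g \in bounded_pred.
Proof.
rewrite one_bounded_predP; split=> wB g.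
  by apply/bounded_predP; exact: wB.
exact/bounded_predP/wB.
Qed.

Lemma one_bounded_submod_closed n : subsemimod_closed (@one_bounded_pred n).
Proof.
case: n => [|n].
  have T0 (w : CR 0) : w \in @one_bounded_pred 0 by apply/one_bounded_predP.
  by split=> [|a w _]; [split=> [|v w _ _]|]; exact: T0.
split=> [|a w /one_bounded_predS wB]; last first.
  apply/one_bounded_predS => g; exact: (@rpredZ _ _ bounded_pred a _ (wB g)).
split=> [|v w /one_bounded_predS vB /one_bounded_predS wB];
  apply/one_bounded_predS => g; first exact: (rpred0 bounded_pred).
exact: (rpredD (vB g) (wB g)).
Qed.

HB.instance Definition _ n := GRing.isSubmodClosed.Build R (CR n)
  (@one_bounded_pred n) (@one_bounded_submod_closed n).

Definition linfty_incl : gmod_hom linfty (gcoind G R^o) :=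
  @GmodHom _ _ linfty (gcoind G R^o) (@submod_val _ _ bounded_pred)
    (fun _ _ => erefl).

(* Lambda_0 w (g_1, ..., g_n) (h) = w (h, g_1, ..., g_n) *)
Definition Lambda0_fun n (w : submod (@one_bounded_pred n.+1)) :
    gcomplex linfty n :=
  fun g => Submod ((one_bounded_predS (submod_val w)).1 (submod_valP w) g).

Lemma Lambda0_is_linear n : linear (@Lambda0_fun n).
Proof. by move=> a v w; apply/funext => g; apply: val_inj. Qed.

HB.instance Definition _ n := GRing.isLinear.Build R
  (submod (@one_bounded_pred n.+1)) (gcomplex linfty n) _
  (@Lambda0_fun n) (@Lambda0_is_linear n).

Definition Lambda0 n :
    {linear submod (@one_bounded_pred n.+1) -> gcomplex linfty n} :=
  @Lambda0_fun n.

Arguments Lambda0 {n}.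

(* This says that codiff (Lambda0 w) + Lambda0 (codiff w) is [w] viewed as a
   cochain of constant functions, in a form that makes sense before [codiff w]
   is known to be 1-bounded; see [Lambda0_codiff]. *)
Lemma curry_codiff n (w : submod (@one_bounded_pred n.+1)) :
  curry_cochain (codiff (submod_val w)) =
  linfty_incl \o
    (const_linfty \o (submod_val w : CR n.+1) - codiff (Lambda0 w)).
Proof.
rewrite [LHS]curry_gcodiffE.
have -> : curry_cochain (submod_val w) = linfty_incl \o Lambda0 w.
  by [].
rewrite gcodiff_ghom.
by apply/funext => g.
Qed.

Fact one_bounded_codiff n w :
  w \in @one_bounded_pred n -> codiff w \in @one_bounded_pred n.+1.
Proof.
case: n w => [|n] w wB; apply/one_bounded_predS => g.
  suff -> : curry_cochain (codiff w) g = 0 by exact: rpred0.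
  apply/funext => h; rewrite /curry_cochain.
  by rewrite [LHS](gcodiff0E (a := w) _ g) subrr.
have := curry_codiff (Submod wB) => /= ->.
exact: submod_valP.
Qed.

Definition one_bounded_complex : cochain_complex R :=
  subcomplex one_bounded_codiff.

Local Notation CB := one_bounded_complex.

Definition comparison n :
    {linear cohomology CB n -> cohomology CR n} :=
  cohomology_map (subcomplex_incl one_bounded_codiff) n.

Definition Lambda n : {linear CB n.+1 -> gcomplex linfty_mod_const n} :=
  coef_map linfty_proj n \o Lambda0.

Lemma Lambda0_codiff n (w : CB n.+1) :
  Lambda0 (codiff w) = const_linfty \o submod_val w - codiff (Lambda0 w).
Proof.
apply/funext => g; apply: val_inj.
exact: (congr1 (@^~ g) (curry_codiff w)).
Qed.

Lemma Lambda_codiff n (w : CB n.+1) :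
  Lambda n.+1 (codiff w) = - codiff (Lambda n w).
Proof.
rewrite /Lambda /= [Lambda0_fun _]Lambda0_codiff linearB.
rewrite -[RHS]sub0r (cmap_codiff (coef_map linfty_proj)); congr (_ - _).
by apply/funext => g; apply/linfty_exact; exists (submod_val w g).
Qed.

Fact Lambda_cocycle n (w : CB n.+1) : codiff w = 0 -> codiff (Lambda n w) = 0.
Proof.
by move=> wZ; apply: oppr_inj; rewrite -Lambda_codiff wZ linear0 oppr0.
Qed.

Fact Lambda_coboundary n (w : CB n.+1) :
  is_coboundary w -> is_coboundary (Lambda n w).
Proof.
case: n w => [|n] _ [b <-]; last first.
  by exists (- Lambda n b); rewrite linearN -Lambda_codiff.
suff -> : codiff b = 0 by exact: linear0.
apply: val_inj; apply/funext => g.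
by rewrite [LHS](gcodiff0E _ (fun i => g (lift ord0 i))) subrr.
Qed.

Definition Lambda_cohomology n :
    {linear cohomology CB n.+1 -> cohomology (gcomplex linfty_mod_const) n} :=
  induced (@Lambda_cocycle n) (@Lambda_coboundary n).

End OneBounded.

Arguments Lambda0 {G R n}.
Arguments Lambda {G R n}.
Arguments Lambda_cohomology G R n.
Arguments comparison G R n.

(* Main.v *)
Require Import Defs.
From HB Require Import structures.
From mathcomp Require Import all_boot all_order all_algebra reals.
From mathcomp Require Import boolp functions.

(** Both parts rest on the identity
      [Lambda0 (codiff w) = const_linfty \o w - codiff (Lambda0 w)]
    for a 1-bounded cochain [w] of positive degree.

    For a cocycle [w] it reads [const_linfty \o w = codiff (Lambda0 w)]: the
    cochain [Lambda0 w] lifts [Lambda w] to bounded functions, and its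
    codifferential is [w] itself, seen as a cochain of constant functions.
    This is exactly the zigzag that computes the connecting homomorphism, which
    therefore sends the class of [Lambda w] to the class of [w].

    For the isomorphism, [Lambda] is surjective on cochains, so everything
    depends on its kernel.  The kernel consists of the cochains that do not
    depend on their first argument, that is, of the cochains [ignore_first e]
    with [ignore_first e (h, g) = e g] for an arbitrary real cochain [e] of
    degree one less, and the identity above becomes
      [codiff (ignore_first e) = ignore_first (ignore_first e - codiff e)].
    This kernel complex is acyclic: evaluation of the first argument at 1 is a
    contracting homotopy ([ignore_first_homotopy]).  Hence every cocycle of the
    kernel is the codifferential of an element of the kernel
    ([Lambda_kernel_acyclic]), and the usual diagram chase concludes: a lift of
    a cocycle can be corrected by an element of the kernel so as to become a
    cocycle, and a cocycle whose image is a coboundary differs from a coboundary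
    by a cocycle of the kernel.  In the lowest degree the kernel contains no
    nonzero cocycle ([Lambda_kernel_cocycle1]), in accordance with the fact that
    the only coboundary of degree one is 0. *)

Set Implicit Arguments.
Unset Strict Implicit.
Unset Printing Implicit Defensive.

Import GRing.Theory.

Local Open Scope ring_scope.

Section NonequivariantMaps.
Variables (G : groupType) (R : pzRingType).

(** In the codifferential the action appears in the first term only, so a linear
    map commutes with codifferentials up to its lack of equivariance there. *)
Lemma gcodiff_linear (U V : gmodule G R) (f : {linear U -> V}) n
    (a : ('I_n -> G) -> U) g :
  let a' := a (fun i => g (lift ord0 i)) in
  gcodiff V (f \o a) g
  = f (gcodiff U a g) + (gact (g ord0) (f a') - f (gact (g ord0) a')).
Proof.
move=> a'; rewrite /= /gcodiff_fun !linearD linear_sum linearZ /=.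
under [in RHS]eq_bigr => k _ do rewrite linearZ.
have E (x y s t : V) : x + s + t = y + s + t + (x - y).
  by rewrite -!(addrA _ s) [RHS]addrC [RHS]addrA subrK.
exact: E.
Qed.

End NonequivariantMaps.

Section LambdaKernel.
Variables (G : groupType) (R : realType).

Local Notation Rtriv := (gtrivial G R).
Local Notation CR := (gcomplex Rtriv).
Local Notation CB := (one_bounded_complex G R).
Local Notation linfty := (linfty G R).
Local Notation const_linfty := (const_linfty G R).

Definition uncurry_fun n (b : gcomplex linfty n) : CR n.+1 :=
  fun g => submod_val (b (fun i => g (lift ord0 i))) (g ord0).

Lemma curry_uncurry n (b : gcomplex linfty n) g :
  curry_cochain (uncurry_fun b) g = submod_val (b g).
Proof.
apply/funext => h; rewrite /curry_cochain /uncurry_fun gcons0.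
by congr (submod_val (b _) _); apply/funext => i; rewrite gconsS.
Qed.

Lemma uncurry_one_bounded n (b : gcomplex linfty n) :
  uncurry_fun b \in @one_bounded_pred G R n.+1.
Proof.
by apply/one_bounded_predS => g; rewrite curry_uncurry; exact: submod_valP.
Qed.

Definition uncurry n (b : gcomplex linfty n) : CB n.+1 :=
  Submod (uncurry_one_bounded b).

Lemma uncurryK n : cancel (@uncurry n) Lambda0.
Proof.
move=> b; apply/funext => g; apply: val_inj; exact: curry_uncurry.
Qed.

Lemma Lambda0_inj n : injective (@Lambda0 G R n).
Proof.
move=> v w vw; apply: val_inj; apply/funext => g; rewrite /= -(gcons_eta g).
exact: (congr1 (fun b : gcomplex linfty n => submod_val (b _) _) vw).
Qed.

Lemma Lambda_surj n (c : gcomplex (linfty_mod_const G R) n) :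
  exists w : CB n.+1, Lambda w = c.
Proof.
have [b <-] := coef_surjective (linfty_ses G R) c.
by exists (uncurry b); rewrite /Lambda /= [Lambda0_fun _]uncurryK.
Qed.

Definition ignore_first n (e : CR n) : CB n.+1 := uncurry (const_linfty \o e).

Lemma ignore_firstE n (e : CR n) g :
  submod_val (ignore_first e) g = e (fun i => g (lift ord0 i)).
Proof. by []. Qed.

Lemma Lambda_ignore_first n (e : CR n) : Lambda (ignore_first e) = 0.
Proof.
rewrite /Lambda /= [Lambda0_fun _]uncurryK.
by apply/(coef_exact (linfty_ses G R)); exists e.
Qed.

Lemma Lambda_eq0 n (w : CB n.+1) :
  Lambda w = 0 -> exists e : CR n, w = ignore_first e.
Proof.
move=> /(coef_exact (linfty_ses G R))[e eE]; exists e.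
by apply: Lambda0_inj; rewrite -[LHS]eE uncurryK.
Qed.

Lemma codiff_ignore_first n (e : CR n) :
  codiff (ignore_first e) = ignore_first (submod_val (ignore_first e) - codiff e).
Proof.
apply: Lambda0_inj; rewrite Lambda0_codiff !uncurryK.
rewrite (gcodiff_ghom const_linfty).
by apply/funext => g; apply: val_inj.
Qed.

Lemma ignore_first0 n : ignore_first (0 : CR n) = 0.
Proof. by apply: val_inj. Qed.

Lemma ignore_first_inj n : injective (@ignore_first n).
Proof.
move=> d e de; apply/funext => g.
have := congr1 (fun w : CB n.+1 => submod_val w (gcons 1%g g)) de.
rewrite !ignore_firstE.
by have -> : (fun i => gcons 1%g g (lift ord0 i)) = g
  by apply/funext => i; rewrite gconsS.
Qed.

Definition eval1 (F : gcoind G R^o) : Rtriv := F 1%g.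

Lemma eval1_is_linear : linear eval1.
Proof. by []. Qed.

HB.instance Definition _ :=
  GRing.isLinear.Build R (gcoind G R^o) Rtriv _ eval1 eval1_is_linear.

Definition eval_first n (e : CR n.+1) : CR n := eval1 \o curry_cochain e.

(** Let [d e := ignore_first e - codiff e], which is the codifferential of the
    kernel of [Lambda] written in terms of the cochains [e]; then [eval_first] is
    a contracting homotopy for [d].  Evaluation at 1 is not equivariant: moving
    it past the codifferential of the curried cochain costs
    [ignore_first (eval_first e) - e], and this term is where [e] comes from. *)
Lemma ignore_first_homotopy n (e : CR n.+1) :
  e = (submod_val (ignore_first (eval_first e)) - codiff (eval_first e))
      + eval_first (submod_val (ignore_first e) - codiff e).
Proof.
apply/funext => g; pose tl : 'I_n -> G := fun i => g (lift ord0 i).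
have D : codiff (eval_first e) g
    = gcodiff (gcoind G R^o) (curry_cochain e) g 1%g
      + (eval_first e tl - e g).
  rewrite [LHS]gcodiff_linear; congr (_ + (_ - _)).
  rewrite /= /eval1 /rtransl_fun mul1g /curry_cochain.
  by rewrite gcons_eta.
have D1 : eval_first (codiff e) g
    = e g - gcodiff (gcoind G R^o) (curry_cochain e) g 1%g.
  exact: curry_gcodiff.
have P1 : eval_first (submod_val (ignore_first e)) g = e g.
  by rewrite /eval_first /= /eval1 curry_uncurry.
transitivity (eval_first e tl - codiff (eval_first e) g
    + (eval_first (submod_val (ignore_first e)) g - eval_first (codiff e) g));
  last by [].
rewrite D D1 P1; move: (gcodiff (gcoind G R^o) _ g 1%g) => d.
by rewrite subKr opprD addrA addrAC subrK subKr.
Qed.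

(** The kernel complex starts here: a real cochain [e] of degree 0 has
    [codiff e = 0], so [codiff (ignore_first e)] vanishes only if
    [ignore_first e] does. *)
Lemma Lambda_kernel_cocycle1 (w : CB 1) :
  Lambda w = 0 -> codiff w = 0 -> w = 0.
Proof.
move=> /Lambda_eq0[e ->]; rewrite codiff_ignore_first.
have -> : codiff e = 0.
  apply/funext => g.
  by rewrite [LHS](gcodiff0E _ (fun i => g (lift ord0 i))) subrr.
rewrite subr0 => pZ; apply: val_inj; apply: ignore_first_inj.
by rewrite pZ ignore_first0.
Qed.

(** The kernel cocycle [ignore_first e] is the codifferential of
    [ignore_first (eval_first e)], since [ignore_first_homotopy] loses its last
    term. *)
Lemma Lambda_kernel_acyclic n (w : CB n.+2) :
  Lambda w = 0 -> codiff w = 0 ->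
  exists2 v : CB n.+1, Lambda v = 0 & codiff v = w.
Proof.
move=> /Lambda_eq0[e ->] dZ; exists (ignore_first (eval_first e)).
  exact: Lambda_ignore_first.
rewrite codiff_ignore_first; congr ignore_first.
rewrite [RHS]ignore_first_homotopy.
have -> : submod_val (ignore_first e) - codiff e = 0.
  by apply: ignore_first_inj; rewrite -codiff_ignore_first dZ ignore_first0.
exact: esym (addr0 _).
Qed.

(** The codifferential of a lift of [c] is a cocycle of the kernel of [Lambda],
    hence the codifferential of an element [v] of the kernel; the lift minus [v]
    is a cocycle with the same image. *)
Lemma Lambda_cocycle_surj n (c : gcomplex (linfty_mod_const G R) n) :
  codiff c = 0 -> exists2 w : CB n.+1, codiff w = 0 & Lambda w = c.
Proof.
move=> cZ; have [w wc] := Lambda_surj c.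
have [||v vL vd] := @Lambda_kernel_acyclic n (codiff w).
- by rewrite Lambda_codiff wc cZ oppr0.
- exact: codiffK.
by exists (w - v); rewrite linearB ?vd ?subrr // vL wc subr0.
Qed.

(** If [Lambda w] is the codifferential of [c] and [b] lifts [c], then
    [w + codiff b] is a cocycle of the kernel of [Lambda]; the sign is that of
    the anticommutation. *)
Lemma Lambda_coboundary_lift n (w : CB n.+1) :
  codiff w = 0 -> is_coboundary (Lambda w) -> is_coboundary w.
Proof.
case: n w => [|n] w wZ => [LZ|[c cL]].
  by exists 0; rewrite linear0; apply/esym/Lambda_kernel_cocycle1.
have [b bc] := Lambda_surj c.
have [||v vL vd] := @Lambda_kernel_acyclic n (w + codiff b).
- by rewrite linearD Lambda_codiff bc cL subrr.
- by rewrite linearD wZ codiffK addr0.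
by exists (v - b); rewrite linearB vd addrK.
Qed.

Lemma Lambda_cohomology_inj n : injective (Lambda_cohomology G R n).
Proof.
have ker0 x : Lambda_cohomology G R n x = 0 -> x = 0.
  have [z <-] := cohomology_class_surj x.
  rewrite /Lambda_cohomology inducedE => /cohomology_class_eq0 zB.
  by apply/cohomology_class_eq0; exact: Lambda_coboundary_lift (cocycleP z) zB.
exact: raddf_inj ker0.
Qed.

Lemma Lambda_cohomology_surj n y : exists x, Lambda_cohomology G R n x = y.
Proof.
have [c <-] := cohomology_class_surj y.
have [w wZ wc] := Lambda_cocycle_surj (cocycleP c).
exists (cohomology_class CB n.+1 (Submod (cocycleI wZ))).
rewrite /Lambda_cohomology inducedE; congr (cohomology_class _ _ _).
exact: val_inj.
Qed.

(** For the lift [Lambda0 z] of [Lambda z] the zigzag returns the cocycle [z]. *)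
Lemma bockstein_Lambda n x :
  bockstein (linfty_ses G R) n (Lambda_cohomology G R n x)
  = comparison G R n.+1 x.
Proof.
have [z <-] := cohomology_class_surj x.
rewrite /Lambda_cohomology /comparison /cohomology_map !inducedE.
apply: (connectingE (b := Lambda0 (submod_val z))) => //.
apply/eqP; rewrite -subr_eq0; apply/eqP.
by rewrite -[LHS]Lambda0_codiff cocycleP linear0.
Qed.

End LambdaKernel.

Theorem theorem3p3 (R : realType) (G : groupType) (n : nat) :
  bijective (Lambda_cohomology G R n) /\
  (forall x : cohomology (one_bounded_complex G R) n.+1,
     bockstein (linfty_ses G R) n (Lambda_cohomology G R n x)
     = comparison G R n.+1 x).
Proof.
split; last exact: bockstein_Lambda.
exists (fun y => sval (cid (Lambda_cohomology_surj y))) => [x|y].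
  by apply: Lambda_cohomology_inj; case: cid.
by case: cid.
Qed.
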